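(* Let $(\Omega,\Sigma,\mu)$ be a $\sigma$-finite complete measure space in which every singleton set has positive measure, let $\phi$ be an Orlicz function, and let $\tau:\Omega\to\Omega$ be a nonsingular measurable transformation such that the composition operator $C_\tau f=f\circ\tau$ is a bounded operator from the Orlicz space $L^\phi(\Omega)$ into itself. If for all integers $k\ge0$ the map $\tau:R(\tau^k)\to R(\tau^k)$ is not one-to-one, then the descent of $C_\tau$ on $L^\phi(\Omega)$ is infinite.
   Context: An Orlicz function is a non-decreasing continuous convex function $\phi:[0,\infty)\to[0,\infty)$ with $\phi(x)=0$ if and only if $x=0$, $\lim_{x\to0}\phi(x)/x=0$ and $\lim_{x\to\infty}\phi(x)/x=\infty$. The Orlicz space $L^\phi(\Omega)$ is the set of ($\mu$-a.e. equivalence classes of) measurable functions $f$ with $\int_\Omega\phi(\alpha|f|)\,d\mu<\infty$ for some $\alpha>0$; it is a Banach space under the Luxemburg norm $\|f\|_\phi=\inf\{k>0:\int_\Omega\phi(|f|/k)\,d\mu\le1\}$. A measurable transformation $\tau:\Omega\to\Omega$ (i.e. $\tau^{-1}(A)\in\Sigma$ for all $A\in\Sigma$) is nonsingular if $\mu(\tau^{-1}(A))=0$ whenever $A\in\Sigma$ and $\mu(A)=0$. That every singleton has positive measure includes that every singleton is in $\Sigma$. $\tau^k$ denotes the $k$-fold composition, $\tau^0$ is the identity map, and $R(\tau^k)=\tau^k(\Omega)$ is the range of $\tau^k$. For an operator $T$ on a vector space with ranges $R(T^k)$, the descent of $T$ is the smallest natural number $k$ (natural numbers being the positive integers) such that $R(T^k)=R(T^{k+1})$;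 if no such $k$ exists, the descent is infinite. *)

(* Defs.v *)
From HB Require Import structures.
From mathcomp Require Import all_boot all_order all_algebra.
From mathcomp Require Import all_classical all_reals all_analysis.

Set Implicit Arguments.
Unset Strict Implicit.
Unset Printing Implicit Defensive.

Import Order.TTheory GRing.Theory Num.Theory.
Import numFieldNormedType.Exports.

Local Open Scope classical_set_scope.
Local Open Scope ring_scope.

(* A function from [0, +oo[ to [0, +oo[ is represented by a total function on R
   constrained on [0, +oo[ only; its values at negative reals are never used. *)
Record orlicz_function (R : realType) (phi : R -> R) : Prop := OrliczFunction {
  orlicz_ge0 : forall x, 0 <= x -> 0 <= phi x ;
  orlicz_nondecreasing : {in `[0, +oo[ &, {homo phi : x y / x <= y}} ;
  orlicz_continuous : {within `[0, +oo[%classic, continuous phi} ;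
  orlicz_convex : convex_function (`[0, +oo[%classic : set R) phi ;
  orlicz_eq0 : forall x, 0 <= x -> (phi x = 0 <-> x = 0) ;
  orlicz_at0 : phi x / x @[x --> 0^'+] --> 0 ;
  orlicz_aty : phi x / x @[x --> +oo] --> +oo
}.

Section orlicz_space.
Context d (T : measurableType d) (R : realType).
Variables (mu : {measure set T -> \bar R}) (phi : R -> R).

Definition finite_orlicz (f : T -> R) : Prop :=
  exists2 a : R, 0 < a & (\int[mu]_x (phi (a * `|f x|))%:E < +oo)%E.

(* The elements of {mfun_ mu, T >-> R} are classes of measurable functions
   modulo mu-a.e. equality, coerced to functions by choosing a representative;
   the integrals do not depend on the representative. *)
Definition orlicz_space : Type :=
  {f : {mfun_ mu, T >-> measurableTypeR R} | finite_orlicz f}.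

Definition luxemburg_norm (f : orlicz_space) : R :=
  inf [set k : R | 0 < k /\ (\int[mu]_x (phi (`|sval f x| / k))%:E <= 1)%E].

(* For the linear operators on [orlicz_space], this is boundedness with respect
   to the Luxemburg norm; composition operators are always linear. *)
Definition bounded_operator (A : orlicz_space -> orlicz_space) : Prop :=
  exists M : R, forall f, luxemburg_norm (A f) <= M * luxemburg_norm f.

End orlicz_space.

Section composition.
Context d (T : measurableType d) (R : realType).
Variable mu : {measure set T -> \bar R}.

Definition nonsingular (tau : T -> T) : Prop :=
  forall A, measurable A -> mu A = 0%E -> mu (tau @^-1` A) = 0%E.

Local Open Scope quotient_scope.

Definition comp_class (tau : {mfun T >-> T})
    (f : {mfun_ mu, T >-> measurableTypeR R}) :
    {mfun_ mu, T >-> measurableTypeR R} :=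
  \pi_({mfun_ mu, T >-> measurableTypeR R})
    ([the {mfun T >-> measurableTypeR R} of repr f \o tau]).

(* Nonsingularity makes [comp_class] independent of the representative. *)
Lemma comp_class_pi (tau : {mfun T >-> T})
    (f : {mfun T >-> measurableTypeR R}) : nonsingular tau ->
  comp_class tau (\pi f) =
  \pi_({mfun_ mu, T >-> measurableTypeR R})
    ([the {mfun T >-> measurableTypeR R} of f \o tau]).
Proof.
move=> nst; apply/eqmodP/asboolP => /=.
have /eqmodP/asboolP : repr (\pi_({mfun_ mu, T >-> measurableTypeR R}) f)
    = f %[mod {mfun_ mu, T >-> measurableTypeR R}] by rewrite reprK.
move=> [N [mN N0 subN]]; exists (tau @^-1` N); split.
- by rewrite -[_ @^-1` _]setTI; exact: measurable_funPT.
- exact: nst.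
- move=> x /= nx; apply: subN => /= h; apply: nx => _; exact: h.
Qed.

Definition composition_operator (phi : R -> R) (tau : {mfun T >-> T})
    (C : orlicz_space mu phi -> orlicz_space mu phi) : Prop :=
  forall f, sval (C f) = comp_class tau (sval f).

End composition.

Definition stable_range (V : Type) (A : V -> V) (k : nat) : bool :=
  (0 < k)%N && `[< range (iter k A) = range (iter k.+1 A) >].

(* The least positive k such that A^k and A^(k+1) have the same range; [None]
   stands for an infinite descent. *)
Definition descent (V : Type) (A : V -> V) : option nat :=
  if pselect (exists k, stable_range A k) is left ex then Some (ex_minn ex)
  else None.

(* Main.v *)
Require Import Defs.
From HB Require Import structures.
From mathcomp Require Import all_boot all_order all_algebra.
From mathcomp Require Import all_classical all_reals all_analysis.
From mathcomp Require Import measurable_realfun.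
Import Order.TTheory GRing.Theory Num.Theory.
Import numFieldNormedType.Exports.
Local Open Scope classical_set_scope.
Local Open Scope ring_scope.

(** Since every point has positive measure, two almost everywhere equal
    functions are equal everywhere ([mfun_class_eq_pointwise]), so that the
    composition operator acts on honest functions and its [k]-th iterate is
    pointwise composition with [tau^k] ([iter_composition_pointwise]). Suppose
    that the ranges of [C^k] and [C^(k+1)] agree. As [tau] is not injective on
    the range of [tau^k], there are points [u] and [v] with
    [tau^k u <> tau^k v] but [tau^(k+1) u = tau^(k+1) v]. Every function in
    the range of [C^(k+1)] takes the same value at [u] and [v]. The indicator
    of the point [tau^k u] belongs to the Orlicz space, because
    sigma-finiteness makes the measure of a point finite
    ([sigma_finite_singleton_lty], [finite_orlicz_indic]), and its image under
    [C^k] is [1] at [u] and [0] at [v]: a contradiction. *)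

Section positive_singletons.
Context {d : measure_display} {T : measurableType d} {R : realType}.
Context {mu : {measure set T -> \bar R}}.

Local Open Scope quotient_scope.

(** A point where the functions differ would lie in a null set. *)
Lemma mfun_class_eq_pointwise {f g : {mfun T >-> measurableTypeR R}} :
  (forall x : T, measurable [set x] /\ (0 < mu [set x])%E) ->
  f = g %[mod {mfun_ mu, T >-> measurableTypeR R}] -> f =1 g.
Proof.
move=> mu1 /eqmodP/asboolP [N [mN N0 subN]] x; apply: contrapT => fgx.
have [mx] := mu1 x; apply/negP; rewrite -leNgt -N0.
apply: le_measure; rewrite ?inE// => _ ->.
by apply: subN => /= fg; apply: fgx; exact: fg.
Qed.

Lemma iter_composition_pointwise {phi : R -> R} {tau : {mfun T >-> T}}
    {C : orlicz_space mu phi -> orlicz_space mu phi}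
    (k : nat) (f : orlicz_space mu phi) (x : T) :
  (forall x : T, measurable [set x] /\ (0 < mu [set x])%E) ->
  composition_operator tau C ->
  repr (sval (iter k C f)) x = repr (sval f) (iter k tau x).
Proof.
move=> mu1 CE; elim: k x => [//|k IHk] x.
rewrite [in RHS]iterSr -IHk iterS CE /comp_class.
pose g := [the {mfun T >-> measurableTypeR R} of
  repr (sval (iter k C f)) \o tau].
by apply: (mfun_class_eq_pointwise (g := g) mu1); rewrite reprK.
Qed.

Lemma sigma_finite_singleton_lty (x : T) :
  sigma_finite [set: T] mu -> measurable [set x] -> (mu [set x] < +oo)%E.
Proof.
move=> [F UF Ffin] mx.
have [i _ Fx] : (\bigcup_i F i) x by rewrite -UF.
have [mF] := Ffin i; apply: le_lt_trans.
by apply: le_measure; rewrite ?inE// => _ ->.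
Qed.

(** As [phi 0 = 0], the modular of the indicator of [A] is [phi 1 * mu A]. *)
Lemma finite_orlicz_indic {phi : R -> R} {A : set T} {f : T -> R} :
  orlicz_function phi -> measurable A -> (mu A < +oo)%E ->
  f =1 \1_A -> finite_orlicz mu phi f.
Proof.
move=> ophi mA Afin fE; exists 1 => //.
have phi0 : phi 0 = 0 by apply/(orlicz_eq0 ophi (lexx 0)).
have phi1 : 0 <= phi 1 by exact: (orlicz_ge0 ophi).
under eq_integral => x _.
  have -> : phi (1 * `|f x|) = phi 1 * \1_A x.
    rewrite fE mul1r indicE; case: (x \in A) => /=.
      by rewrite normr1 mulr1.
    by rewrite normr0 phi0 mulr0.
  rewrite EFinM; over.
rewrite ge0_integralZl//; last first.
  apply/measurable_EFinP.
  exact: measurable_indic.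
rewrite integral_indic// setIT.
by apply: lte_mul_pinfty; rewrite ?lee_fin.
Qed.

End positive_singletons.

Theorem theorem3p9 (d : measure_display) (T : measurableType d) (R : realType)
    (mu : {measure set T -> \bar R})
    (mu_sigma_finite : sigma_finite [set: T] mu)
    (mu_complete : measure_is_complete mu)
    (mu_singleton : forall x : T, measurable [set x] /\ (0 < mu [set x])%E)
    (phi : R -> R) (phi_orlicz : orlicz_function phi)
    (tau : {mfun T >-> T}) (tau_nonsingular : nonsingular mu tau)
    (C : orlicz_space mu phi -> orlicz_space mu phi)
    (C_composition : composition_operator tau C)
    (C_bounded : bounded_operator C)
    (tau_not_inj : forall k : nat, ~ set_inj (range (iter k tau)) tau) :
  descent C = None.
Proof.
rewrite /descent; case: pselect => // exk; exfalso.
have [k /andP[_ /asboolP rangeE]] := exk.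
apply: (tau_not_inj k) => _ _ /set_mem[u _ <-] /set_mem[v _ <-] tauE.
apply: contrapT => uv; have [ma _] := mu_singleton (iter k tau u).
(* The two Borel sigma-algebras on R have convertible measurable sets. *)
have mh : measurable_fun setT
    (\1_[set iter k tau u] : T -> measurableTypeR R).
  exact: (@measurable_indic _ _ R).
pose h : {mfun T >-> measurableTypeR R} :=
  HB.pack (\1_[set iter k tau u] : T -> measurableTypeR R)
    (isMeasurableFun.Build _ _ _ _ _ mh).
pose f := (\pi_({mfun_ mu, T >-> measurableTypeR R}) h)%qT.
have fE : repr f =1 \1_[set iter k tau u].
  by apply: (mfun_class_eq_pointwise (g := h) mu_singleton); rewrite reprK.
have fL : finite_orlicz mu phi (repr f).
  by apply: (finite_orlicz_indic (f := repr f) phi_orlicz ma _ fE);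
    exact: sigma_finite_singleton_lty.
pose F : orlicz_space mu phi := exist _ f fL.
have [g _ gE] : range (iter k.+1 C) (iter k C F) by rewrite -rangeE; exists F.
have fg x : \1_[set iter k tau u] (iter k tau x)
    = repr (sval g) (tau (iter k tau x)).
  rewrite -fE -[f]/(sval F) -iterS.
  by rewrite -!(iter_composition_pointwise _ _ _ mu_singleton C_composition) gE.
have /eqP := fg u; rewrite tauE -fg !indicE mem_set// memNset ?oner_eq0//.
by move=> /= vu; apply: uv.
Qed.
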